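(* Let $n\in\mathbb{N}$, let $(\mathcal{K},[\cdot,\cdot])$ be a Krein space with fundamental symmetry $J$, let $(\mathcal{M},\mathfrak{B},\nu)$ be a signed measure space, let $0<a\le b$, and let $\{\eta_x^1,\eta_x^2,\ldots,\eta_x^n\}_{x\in\mathcal{M}}\subset\mathcal{K}$ be a family of vectors. The following statements are equivalent: (i) $\{\eta_x^1,\ldots,\eta_x^n\}_{x\in\mathcal{M}}$ is a continuous frame of rank $n$ for the Krein space $(\mathcal{K},[\cdot,\cdot])$ with frame bounds $a\le b$. (ii) $\{\eta_x^1,\ldots,\eta_x^n\}_{x\in\mathcal{M}}$ is a continuous frame of rank $n$ for the Hilbert space $(\mathcal{K},[\cdot,\cdot]_J)$ with frame bounds $a\le b$. (iii) $\{J\eta_x^1,\ldots,J\eta_x^n\}_{x\in\mathcal{M}}$ is a continuous frame of rank $n$ for the Krein space $(\mathcal{K},[\cdot,\cdot])$ with frame bounds $a\le b$. (iv) $\{J\eta_x^1,\ldots,J\eta_x^n\}_{x\in\mathcal{M}}$ is a continuous frame of rank $n$ for the Hilbert space $(\mathcal{K},[\cdot,\cdot]_J)$ with frame bounds $a\le b$. (All frames are with respect to $(\mathcal{M},\mathfrak{B},\nu)$.)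
   Context: Krein spaces are complex; the inner product $[\cdot,\cdot]$ is Hermitian, conjugate-linear in the first and linear in the second variable. A Krein space $(\mathcal{K},[\cdot,\cdot])$ comes with a fundamental decomposition $\mathcal{K}=\mathcal{K}_+[\dotplus]\mathcal{K}_-$ (a direct sum, orthogonal with respect to $[\cdot,\cdot]$, such that $(\mathcal{K}_+,[\cdot,\cdot])$ and $(\mathcal{K}_-,-[\cdot,\cdot])$ are Hilbert spaces) and fundamental symmetry $J(k^++k^-)=k^+-k^-$. The $J$-inner product $[h,k]_J:=[h,Jk]$ makes $\mathcal{K}$ a Hilbert space with $J$-norm $\|k\|_J=\sqrt{[k,k]_J}$. A Hilbert space is regarded as a Krein space with fundamental symmetry the identity. $\nu$ is a signed measure on $(\mathcal{M},\mathfrak{B})$, with Hahn decomposition $\{\mathcal{M}_+,\mathcal{M}_-\}$, Jordan decomposition $\nu=\nu^+-\nu^-$ and $|\nu|=\nu^++\nu^-$. A map $\eta:\mathcal{M}\to\mathcal{K}$ is weakly measurable if $x\mapsto[\eta(x),k]$ is measurable for every $k\in\mathcal{K}$. A family $\{\eta_x^1,\ldots,\eta_x^n\}_{x\in\mathcal{M}}$ in $\mathcal{K}$, with $\eta_x^1,\ldots,\eta_x^n$ linearly independent for each $x$, is a continuous frame of rank $n$ for $(\mathcal{K},[\cdot,\cdot])$ with respect to $(\mathcal{M},\mathfrak{B},\nu)$ with frame bounds $0<a\le b$ if each $x\mapsto\eta_x^i$ is weakly measurable and $a\|k\|_J^2\le\sum_{i=1}^n\int_{\mathcal{M}}|[\eta_x^i,k]|^2\,d|\nu|(x)\le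 b\|k\|_J^2$ for all $k\in\mathcal{K}$. For the Hilbert space $(\mathcal{K},[\cdot,\cdot]_J)$ the same definition is used with $[\cdot,\cdot]$ replaced by $[\cdot,\cdot]_J$ and with the same norm $\|\cdot\|_J$. *)

(* Defs.v *)
From HB Require Import structures.
From mathcomp Require Import all_boot all_order all_algebra.
From mathcomp Require Import complex.
From mathcomp Require Import all_classical all_reals all_analysis.

Set Implicit Arguments.
Unset Strict Implicit.
Unset Printing Implicit Defensive.

Import Order.TTheory GRing.Theory Num.Theory.
Import numFieldNormedType.Exports.

Local Open Scope classical_set_scope.
Local Open Scope complex_scope.
Local Open Scope ring_scope.
Local Open Scope charge_scope.

Notation cabs := ComplexField.Normc.normc.

Notation borelC R := (g_sigma_algebraType (@open (R[i])^o)).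

Section form.
Context {R : realType} {V : lmodType R[i]}.
Implicit Types (f : V -> V -> R[i]) (S : {pred V}).

Definition form_norm f (v : V) : R := Num.sqrt (complex.Re (f v v)).

Definition form_posdef f S := forall v, v \in S -> v != 0 -> 0 < f v v.

Definition form_cauchy f (u : nat -> V) := forall e : R, 0 < e ->
  exists N, forall m n, (N <= m)%N -> (N <= n)%N -> form_norm f (u m - u n) < e.

Definition form_complete f S := forall u : nat -> V,
  (forall m, u m \in S) -> form_cauchy f u ->
  exists2 l, l \in S & (fun m => form_norm f (u m - l)) @ \oo --> (0 : R).

(* The subspace S, with the restriction of the sesquilinear Hermitian form f,
   is a Hilbert space. *)
Definition hilbert_on f S :=
  [/\ submod_closed S, form_posdef f S & form_complete f S].

End form.

(* The inner product is conjugate-linear in the first variable and linear in the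
   second, hence not an instance of {hermitian _ for _ & _}, which has the
   opposite convention. *)
Record krein_space (R : realType) := KreinSpace {
  krein_sort :> lmodType R[i] ;
  krein_ip : {bilinear krein_sort -> krein_sort -> R[i]
                | (@Num.conj R[i]) \; *%R & *%R} ;
  krein_herm : forall h k, krein_ip h k = Num.conj (krein_ip k h) ;
  krein_pos : {pred krein_sort} ;
  krein_neg : {pred krein_sort} ;
  krein_pos_hilbert : hilbert_on krein_ip krein_pos ;
  krein_neg_hilbert : hilbert_on (fun h k => - krein_ip h k) krein_neg ;
  krein_sum : forall k, exists kp km,
    [/\ kp \in krein_pos, km \in krein_neg & k = kp + km] ;
  krein_direct : forall k, k \in krein_pos -> k \in krein_neg -> k = 0 ;
  krein_ortho : forall kp km, kp \in krein_pos -> km \in krein_neg ->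
    krein_ip kp km = 0 ;
  krein_J : krein_sort -> krein_sort ;
  krein_JE : forall kp km, kp \in krein_pos -> km \in krein_neg ->
    krein_J (kp + km) = kp - km
}.

Definition krein_ipJ {R : realType} (K : krein_space R) (h k : K) : R[i] :=
  krein_ip K h (krein_J k).

Definition krein_normJ {R : realType} (K : krein_space R) (k : K) : R :=
  form_norm (@krein_ipJ R K) k.

(* Unlike {charge set T -> \bar R}, a signed measure may take one of the two
   infinite values. *)
Record signed_measure d (T : measurableType d) (R : realType) := SignedMeasure {
  smeasure :> set T -> \bar R ;
  smeasure0 : smeasure set0 = 0%E ;
  smeasure_sigma_additive : measure_function.semi_sigma_additive smeasure ;
  smeasure_infty : (forall A, measurable A -> smeasure A != -oo%E) \/
                   (forall A, measurable A -> smeasure A != +oo%E)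
}.

Definition signed_hahn d (T : measurableType d) (R : realType)
    (nu : signed_measure T R) (P N : set T) :=
  [/\ nu.-positive_set P, nu.-negative_set N, P `|` N = setT & P `&` N = set0].

(* The value 0 on non-measurable sets is a convention: measures are nonnegative
   on all sets. *)
Section jordan.
Context d (T : measurableType d) (R : realType) (nu : signed_measure T R).
Context (P N : set T) (PN : signed_hahn nu P N).
Local Open Scope ereal_scope.

Definition smeasure_pos & signed_hahn nu P N := fun A : set T =>
  if A \in measurable then nu (A `&` P) else 0.

Definition smeasure_neg & signed_hahn nu P N := fun A : set T =>
  if A \in measurable then - nu (A `&` N) else 0.

Let pos0 : smeasure_pos PN set0 = 0.
Proof. by rewrite /smeasure_pos set0I smeasure0 if_same. Qed.

Let pos_ge0 A : 0 <= smeasure_pos PN A.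
Proof.
rewrite /smeasure_pos; case: ifPn => // /[1!inE] mA; case: PN => -[mP posP] _ _ _.
by apply: posP; [exact: measurableI|exact: subIsetr].
Qed.

Let pos_additive : semi_sigma_additive (smeasure_pos PN).
Proof.
have [[mP _] _ _ _] := PN; move=> F mF tF mUF.
rewrite /smeasure_pos mem_set// setI_bigcupl.
under eq_fun do under eq_bigr do rewrite mem_set//.
apply: smeasure_sigma_additive => [i||].
- exact: measurableI.
- exact: trivIset_setIr.
- by rewrite -setI_bigcupl; exact: measurableI.
Qed.

HB.instance Definition _ := isMeasure.Build _ _ _ (smeasure_pos PN)
  pos0 pos_ge0 pos_additive.

Let neg0 : smeasure_neg PN set0 = 0.
Proof. by rewrite /smeasure_neg set0I smeasure0 oppe0 if_same. Qed.

Let neg_ge0 A : 0 <= smeasure_neg PN A.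
Proof.
rewrite /smeasure_neg; case: ifPn => // /[1!inE] mA; case: PN => _ -[mN negN] _ _.
by rewrite oppe_ge0; apply: negN; [exact: measurableI|exact: subIsetr].
Qed.

Let neg_additive : semi_sigma_additive (smeasure_neg PN).
Proof.
have [_ [mN negN] _ _] := PN; move=> F mF tF mUF.
have mFN i : measurable (F i `&` N) by exact: measurableI.
rewrite /smeasure_neg mem_set// setI_bigcupl.
under eq_fun do under eq_bigr do rewrite mem_set//.
have le0 i : nu (F i `&` N) <= 0 by apply: negN => //; exact: subIsetr.
have -> : (fun n => \sum_(0 <= i < n) - nu (F i `&` N)) =
          (fun n => - \sum_(0 <= i < n) nu (F i `&` N)).
  apply/funext => n; elim: n => [|n IHn]; first by rewrite !big_geq// oppe0.
  rewrite !big_nat_recr//= IHn oppeD//; apply: ltpinfty_adde_def => /=.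
    by rewrite inE (le_lt_trans _ (ltry 0))//; apply: sume_le0 => i _; exact: le0.
  by rewrite inE (le_lt_trans (le0 n))// ltry.
apply: cvgeN; apply: smeasure_sigma_additive => //.
- exact: trivIset_setIr.
- exact: bigcupT_measurable.
Qed.

HB.instance Definition _ := isMeasure.Build _ _ _ (smeasure_neg PN)
  neg0 neg_ge0 neg_additive.

Definition smeasure_variation : {measure set T -> \bar R} :=
  measure_add (smeasure_pos PN) (smeasure_neg PN).

End jordan.

Section frame.
Context d (T : measurableType d) (R : realType) (nu : signed_measure T R).
Context (P N : set T) (PN : signed_hahn nu P N).

Definition lin_indep (V : lmodType R[i]) n (v : 'I_n -> V) :=
  forall c : 'I_n -> R[i], \sum_(i < n) c i *: v i = 0 -> forall i, c i = 0.

Definition weakly_measurable (V : lmodType R[i]) (f : V -> V -> R[i])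
    (eta : T -> V) :=
  forall k, measurable_fun setT (fun x => f (eta x) k : borelC R).

(* Frames of V for the inner product f and the norm nrm; nrm need not be the one
   induced by f. *)
Definition continuous_frame (V : lmodType R[i]) (f : V -> V -> R[i])
    (nrm : V -> R) n (eta : T -> 'I_n -> V) (a b : R) :=
  [/\ 0 < a <= b,
      forall x, lin_indep (eta x),
      forall i, weakly_measurable f (eta ^~ i) &
      forall k : V,
        ((a * nrm k ^+ 2)%:E
           <= \sum_(i < n)
                \int[smeasure_variation PN]_x (cabs (f (eta x i) k) ^+ 2)%:E
           <= (b * nrm k ^+ 2)%:E)%E].

Definition krein_frame (K : krein_space R) n (eta : T -> 'I_n -> K) (a b : R) :=
  continuous_frame (krein_ip K) (@krein_normJ R K) eta a b.

Definition hilbert_frame (K : krein_space R) n (eta : T -> 'I_n -> K) (a b : R) :=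
  continuous_frame (@krein_ipJ R K) (@krein_normJ R K) eta a b.

End frame.

(* Main.v *)
From HB Require Import structures.
Require Import Defs.
From mathcomp Require Import all_boot all_order all_algebra.
From mathcomp Require Import complex.
From mathcomp Require Import all_classical all_reals all_analysis.
Import Order.TTheory GRing.Theory Num.Theory.
Local Open Scope complex_scope.
Local Open Scope ring_scope.

(** The fundamental symmetry [J] is a linear involution that is self-adjoint
    for the Krein inner product [[.,.]], because it acts as [1] and [-1] on the
    two summands of an orthogonal direct sum. Consequently
    [[h, k]_J = [h, Jk] = [Jh, k]] and [[Jh, k]_J = [h, k]], and [J] preserves
    the [J]-norm. So passing from any of the four frame conditions to the next
    either substitutes [Jk] for the test vector [k], which permutes the vectors
    of [K] without changing their norms, or leaves all the coefficient functions
    [x |-> [eta_x^i, k]] unchanged. Both cases are instances of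
    [continuous_frame_transfer]. Linear independence carries over since [J] is
    linear and injective. *)

Section fundamental_symmetry.
Context {R : realType} (K : krein_space R).
Implicit Types h k : K.
Local Notation J := (@krein_J R K).
Local Notation ip := (krein_ip K).

Lemma krein_ortho_neg_pos {km kp} :
  km \in @krein_neg R K -> kp \in @krein_pos R K -> ip km kp = 0.
Proof. by move=> hm hp; rewrite krein_herm krein_ortho// rmorph0. Qed.

(** Since the two summands of the fundamental decomposition are subspaces,
    linear combinations can be formed componentwise, and [krein_JE] applies to
    the result. *)
Lemma krein_J_linear : linear J.
Proof.
move=> c h k.
have [[_ linp] _ _] := krein_pos_hilbert K.
have [[_ linm] _ _] := krein_neg_hilbert K.
have [hp [hm [hpP hmN ->]]] := krein_sum h.
have [kp [km [kpP kmN ->]]] := krein_sum k.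
rewrite scalerDr addrACA !krein_JE//; [|exact: linp|exact: linm].
by rewrite scalerBr opprD addrACA.
Qed.

Lemma krein_JK : involutive J.
Proof.
move=> k; have [[m0 linm] _ _] := krein_neg_hilbert K.
have [kp [km [kpP kmN ->]]] := krein_sum k.
rewrite !krein_JE// ?opprK//.
by rewrite -scaleN1r -[X in X \in _]addr0; exact: linm.
Qed.

(** The mixed terms vanish by orthogonality, so that both sides equal
    [[h+, k+] - [h-, k-]]. *)
Lemma krein_J_selfadjoint h k : ip (J h) k = ip h (J k).
Proof.
have [hp [hm [hpP hmN ->]]] := krein_sum h.
have [kp [km [kpP kmN ->]]] := krein_sum k.
rewrite !krein_JE// !linearDl !linearDr !linearNl !linearNr/=.
rewrite (krein_ortho hpP kmN) (krein_ortho_neg_pos hmN kpP).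
by rewrite oppr0 !(addr0, add0r).
Qed.

Lemma krein_normJ_J k : krein_normJ (J k) = krein_normJ k.
Proof.
by rewrite /krein_normJ /form_norm /krein_ipJ krein_JK krein_J_selfadjoint.
Qed.

Lemma lin_indep_of_J n (v : 'I_n -> K) :
  lin_indep (fun i => J (v i)) -> lin_indep v.
Proof.
pose J' : {linear K -> K} :=
  HB.pack J (GRing.isLinear.Build _ _ _ _ J krein_J_linear).
move=> indJ c c0; apply: indJ.
have := congr1 J' c0; rewrite linear0 linear_sum.
by under eq_bigr do rewrite linearZ.
Qed.

Lemma lin_indep_J n (v : 'I_n -> K) :
  lin_indep v -> lin_indep (fun i => J (v i)).
Proof.
move=> indv; apply: lin_indep_of_J; under eq_fun do rewrite krein_JK.
exact: indv.
Qed.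

End fundamental_symmetry.

(** The coefficient functions of [eta'] are those of [eta] at the test vectors
    [j k], so measurability and the frame inequalities for [eta'] at [k] are
    those for [eta] at [j k]. *)
Lemma continuous_frame_transfer {d} {T : measurableType d} {R : realType}
    {nu : signed_measure T R} {P N : set T} (PN : signed_hahn nu P N)
    {V : lmodType R[i]} (f g : V -> V -> R[i]) (nrm : V -> R) (j : V -> V)
    n (eta eta' : T -> 'I_n -> V) (a b : R) :
  (forall x i k, g (eta' x i) k = f (eta x i) (j k)) ->
  (forall k, nrm (j k) = nrm k) ->
  (forall x, lin_indep (eta x) -> lin_indep (eta' x)) ->
  continuous_frame PN f nrm eta a b -> continuous_frame PN g nrm eta' a b.
Proof.
move=> gE nrmj ind [ab indeta meas bounds]; split=> // [x|i k|k].
- exact: ind.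
- by under eq_fun do rewrite gE; exact: meas.
- rewrite -nrmj; under eq_bigr do under eq_integral do rewrite gE.
  exact: bounds.
Qed.

Theorem theorem3p5 (R : realType) (n : nat) (K : krein_space R)
    (d : measure_display) (M : measurableType d) (nu : signed_measure M R)
    (Mp Mm : set M) (hahn : signed_hahn nu Mp Mm)
    (a b : R) (hab : 0 < a <= b) (eta : M -> 'I_n -> K) :
  [<-> krein_frame hahn eta a b;
       hilbert_frame hahn eta a b;
       krein_frame hahn (fun x i => krein_J (eta x i)) a b;
       hilbert_frame hahn (fun x i => krein_J (eta x i)) a b].
Proof.
have krein_to_hilbert (zeta : M -> 'I_n -> K) :
    krein_frame hahn zeta a b -> hilbert_frame hahn zeta a b.
  by apply: (continuous_frame_transfer hahn _ _ _ (@krein_J R K)) => // k;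
     exact: krein_normJ_J.
tfae.
- exact: krein_to_hilbert.
- apply: (continuous_frame_transfer hahn _ _ _ id) => // [x i k|x].
    exact: krein_J_selfadjoint.
  exact: lin_indep_J.
- exact: krein_to_hilbert.
- apply: (continuous_frame_transfer hahn _ _ _ id) => // [x i k|x].
    by rewrite /krein_ipJ krein_J_selfadjoint krein_JK.
  exact: lin_indep_of_J.
Qed.
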